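(* Assume $(X,r)$ is a finite left non-degenerate idempotent set-theoretic solution of the Yang--Baxter equation. Then $\Lambda=X$ if and only if there is a permutation $\varphi\in\mathrm{Sym}(X)$ such that $r(x,y)=(\varphi(y),y)$ for all $x,y\in X$. (Such a solution is denoted $(X,r_\varphi)$.) In particular, for a finite set $X$, the number of non-isomorphic finite left non-degenerate idempotent solutions on $X$ with bijective diagonal map equals the number of partitions of the integer $|X|$.
   Context: A set-theoretic solution of the Yang--Baxter equation is a pair $(X,r)$ with $X$ a non-empty set and $r\colon X\times X\to X\times X$ a map satisfying $(r\times\mathrm{id})(\mathrm{id}\times r)(r\times\mathrm{id})=(\mathrm{id}\times r)(r\times\mathrm{id})(\mathrm{id}\times r)$. Write $r(x,y)=(\lambda_x(y),\rho_y(x))$. It is finite if $X$ is finite, left non-degenerate if every $\lambda_x\colon X\to X$ is bijective, and idempotent if $r^2=r$. The diagonal map is $q\colon X\to X$, $q(x)=\lambda_x^{-1}(x)$, and $\Lambda=q(X)$. Two solutions $(X,r)$ and $(Y,s)$ are isomorphic if there is a bijection $f\colon X\to Y$ with $(f\times f)r=s(f\times f)$. *)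

(* Defs.v *)
From HB Require Import structures.
From mathcomp Require Import all_boot all_fingroup.
From mathcomp Require Export boolp.

Set Implicit Arguments.
Unset Strict Implicit.
Unset Printing Implicit Defensive.

Section YangBaxter.
Variable X : Type.
Implicit Type r : X * X -> X * X.

Definition lam r (x y : X) : X := (r (x, y)).1.

(* r x id and id x r, acting on triples ((x, y), z) *)
Definition r12 r (t : X * X * X) : X * X * X := (r t.1, t.2).
Definition r23 r (t : X * X * X) : X * X * X :=
  let u := r (t.1.2, t.2) in (t.1.1, u.1, u.2).

Definition yang_baxter r : Prop :=
  r12 r \o r23 r \o r12 r =1 r23 r \o r12 r \o r23 r.

Definition left_nondegenerate r : Prop := forall x, bijective (lam r x).
End YangBaxter.

Definition isomorphic (X Y : Type) (r : X * X -> X * X) (s : Y * Y -> Y * Y) :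
    Prop :=
  let ff (f : X -> Y) (u : X * X) := (f u.1, f u.2) in
  exists2 f : X -> Y, bijective f & ff f \o r =1 s \o ff f.

Section Diagonal.
Variable X : finType.
Implicit Type r : X * X -> X * X.

(* [finv f] is the two-sided inverse of [f] whenever [f] is injective, so this
   is meaningful for left non-degenerate [r]. *)
Definition diag r (x : X) : X := finv (lam r x) x.

Definition Lambda r : {set X} := [set diag r x | x : X].
End Diagonal.

(* Boolean form of [isomorphic], for solutions on one finite carrier: finite
   functions are used so that the solutions on X form a finite set. *)
Definition iso_rel (X : finType) : rel {ffun X * X -> X * X} :=
  fun r s => `[< isomorphic r s >].

Lemma iso_rel_equiv (X : finType) : equivalence_rel (@iso_rel X).
Proof.
have refl (r : {ffun X * X -> X * X}) : isomorphic r r.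
  by exists id; [exists id | case=> a b /=; case: (r _)].
have sym (r s : {ffun X * X -> X * X}) : isomorphic r s -> isomorphic s r.
  case=> f [g fK gK] fr; exists g; first by exists f.
  move=> [a b] /=; have /= := fr (g a, g b); rewrite !gK => <- /=.
  by rewrite !fK; case: (r _).
have trans (r s t : {ffun X * X -> X * X}) :
    isomorphic r s -> isomorphic s t -> isomorphic r t.
  case=> f bf fr [g bg gs]; exists (g \o f); first exact: bij_comp.
  by move=> u /=; have /= <- := gs (f u.1, f u.2); have /= <- := fr u.
move=> r s t; split; first exact/asboolP.
move=> /asboolP rs; apply: asbool_equiv_eq; split; apply: trans => //.
exact: sym.
Qed.

(* Integer partitions of n: non-increasing sequences of positive integers with
   sum n. *)
Definition is_intpart (n : nat) (p : seq nat) : bool :=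
  [&& sorted geq p, all (fun k => 0 < k) p & sumn p == n].

Record intpart (n : nat) := Intpart
  { intpart_val :> seq nat; intpart_valP : is_intpart n intpart_val }.

HB.instance Definition _ n := [isSub for @intpart_val n].
HB.instance Definition _ n := [Countable of intpart n by <:].

Section IntpartFinite.
Variable n : nat.

Let code (p : intpart n) : n.-bseq 'I_n.+1 := insub_bseq n (map inord p).
Let decode (b : n.-bseq 'I_n.+1) : option (intpart n) := insub (map val b).

Lemma intpart_codeK : pcancel code decode.
Proof.
case=> p pP; rewrite /decode /code /=.
have /and3P[_ p_gt0 /eqP p_sum] := pP.
have sz_le : size p <= n.
  rewrite -p_sum; elim: p p_gt0 {pP p_sum} => //= k p IHp /andP[k0 /IHp].
  by rewrite -add1n; apply: leq_add.
have le_n k : k \in p -> k <= n.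
  move=> kp; rewrite -p_sum sumnE (big_rem k) //=; exact: leq_addr.
have -> : val (insub_bseq n (map (@inord n) p)) = map inord p.
  by rewrite /insub_bseq val_insubd size_map sz_le.
rewrite -map_comp map_id_in; last by move=> k /le_n kn /=; rewrite inordK.
by rewrite insubT; congr Some; apply: val_inj.
Qed.

End IntpartFinite.

HB.instance Definition _ n : isFinite (intpart n) :=
  PCanIsFinite (@intpart_codeK n).

(* Main.v *)
(* By idempotence r (x, y) = (lam_x y, q (lam_x y)).  If q is bijective,
   comparing the last two components of the braid relation gives
   q (lam_x y) = y; hence every lam_x equals the inverse of q.  Two solutions
   r_phi, r_psi are isomorphic iff phi and psi are conjugate, i.e. iff the
   multisets of their cycle lengths agree, and every partition of #|X| occurs
   as such a multiset. *)
Require Import Defs.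
From mathcomp Require Import all_boot all_fingroup.

Set Implicit Arguments.
Unset Strict Implicit.
Unset Printing Implicit Defensive.

(** * Idempotent solutions and their diagonal map *)

Section Classification.
Variable X : finType.
Implicit Type r : X * X -> X * X.

Lemma diagP r x : left_nondegenerate r -> lam r x (diag r x) = x.
Proof. by move=> nd; apply: f_finv; apply/bij_inj/nd. Qed.

(** Idempotence makes [r (x, y)] a fixed point of [r], so [lam r (lam r x y)] sends its second
    component to [lam r x y], as it does [diag r (lam r x y)]; injectivity concludes. *)
Lemma idempotent_snd r x y : left_nondegenerate r -> idempotent_fun r ->
  (r (x, y)).2 = diag r (lam r x y).
Proof.
move=> nd idem; apply: (bij_inj (nd (lam r x y))).
by rewrite diagP // /lam -surjective_pairing; have /= -> := idem (x, y).
Qed.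

Lemma diag_lam r : yang_baxter r -> left_nondegenerate r ->
  idempotent_fun r -> bijective (diag r) ->
  forall x y, diag r (lam r x y) = y.
Proof.
move=> yb nd idem /bij_inj inj_q w u.
have rE x y : r (x, y) = (lam r x y, diag r (lam r x y)).
  by rewrite -idempotent_snd // -surjective_pairing.
have [lV _ lVK] := nd (diag r w).
(* With [q] for [diag r], this triple is fixed by [r12], and [lV u] is chosen so that [r23] sends it
   to [(w, u, q u)]. After [r12] both sides reach [(lam_w u, q (lam_w u), q u)], and the braid
   relation says that [r23] fixes this triple. *)
have := yb (w, diag r w, lV u).
rewrite /= /r12 /r23 /= !(rE, diagP) //= lVK.
case=> e2 e3.
by rewrite e2 -(inj_q _ _ e3).
Qed.

Definition perm_solution (s : X -> X) : X * X -> X * X :=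
  fun u => (s u.2, u.2).

Lemma perm_solution_bij_diag s :
  bijective s -> bijective (diag (perm_solution s)).
Proof.
move=> bs; apply/injF_bij => x y /(congr1 s) /=.
(* Each [lam (perm_solution s) z] is convertible to [s], so [diagP] exhibits the diagonal as a right
   inverse of [s]. *)
have dE z : s (diag (perm_solution s) z) = z.
  exact: (@diagP (perm_solution s) z).
by rewrite !dE.
Qed.

Lemma bij_diag_perm_solution r :
    yang_baxter r -> left_nondegenerate r -> idempotent_fun r ->
    bijective (diag r) ->
  exists phi : {perm X}, r =1 perm_solution phi.
Proof.
move=> yb nd idem bq; have [phi phiK qK] := bq.
have lE x y : lam r x y = phi y.
  by rewrite -[LHS]phiK (diag_lam yb nd idem bq).
exists (perm (can_inj qK)) => -[x y].
rewrite [LHS]surjective_pairing idempotent_snd // -/(lam r x y).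
by rewrite (diag_lam yb nd idem bq) lE /perm_solution /= permE.
Qed.

Lemma Lambda_setT r : Lambda r = [set: X] <-> bijective (diag r).
Proof.
split=> [LT | bq].
  have /imset_injP injq : #|Lambda r| == #|X| by rewrite LT cardsT.
  by apply: injF_bij => x y; apply: injq.
apply/setP=> x; rewrite inE; have [q' _ q'K] := bq.
by rewrite -[x]q'K imset_f.
Qed.
End Classification.

Lemma perm_solution_isomorphic (X : finType) (s t : {perm X}) :
  isomorphic (perm_solution s) (perm_solution t) <->
  exists2 f : X -> X, bijective f & f \o s =1 t \o f.
Proof.
split=> -[f bf e]; exists f => //.
  by move=> y; have /= [] := e (y, y).
by move=> [x y] /=; have /= -> := e y.
Qed.

(** * Orbits of an injective self-map of a finite type *)

Section Orbits.
Variables (T : finType) (f : T -> T).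
Hypothesis injf : injective f.

Lemma fconnectP x y :
  reflect (exists i, y = iter i f x) (fconnect f x y).
Proof.
apply: (iffP idP) => [xy|[i ->]]; last exact: fconnect_iter.
by exists (findex f x y); rewrite iter_findex.
Qed.

Lemma eq_order_fconnect x y : fconnect f x y ->
  fingraph.order f x = fingraph.order f y.
Proof.
by move=> xy; apply/eq_card/(same_connect (fconnect_sym injf) xy).
Qed.

Lemma iter_mod_order i x : iter (i %% fingraph.order f x) f x = iter i f x.
Proof.
rewrite {2}(divn_eq i (fingraph.order f x)) addnC iterD; congr iter.
elim: (i %/ _) => // k IHk.
by rewrite mulSn iterD -IHk iter_order.
Qed.

Lemma eq_iter_order i j x :
  (iter i f x == iter j f x) = (i == j %[mod fingraph.order f x]).
Proof.
apply/eqP/eqP=> [|eij]; last by rewrite -iter_mod_order eij iter_mod_order.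
rewrite -(iter_mod_order i) -(iter_mod_order j).
(* [findex] recovers an exponent smaller than the order. *)
by move/(congr1 (findex f x)); rewrite !findex_iter ?ltn_mod ?order_gt0.
Qed.

(** [froot f] maps any transversal of the orbits bijectively onto the canonical roots and preserves
    orders. Orbit lengths can thus be read off whichever transversal is convenient. *)
Lemma perm_eq_order_transversal (s : seq T) :
    uniq s -> {in s &, forall x y, fconnect f x y -> x = y} ->
    (forall x, exists2 y, y \in s & fconnect f y x) ->
  perm_eq (map (fingraph.order f) s) (map (fingraph.order f) (enum (froots f))).
Proof.
move=> us sI sT; have symf := fconnect_sym injf.
have -> : map (fingraph.order f) s = map (fingraph.order f) (map (froot f) s).
  rewrite -map_comp; apply: eq_map => x /=.
  by apply/eq_order_fconnect/connect_root.
apply/perm_map/uniq_perm => [||x].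
- rewrite map_inj_in_uniq // => x y xs ys /(rootP symf); exact: sI.
- exact: enum_uniq.
- rewrite mem_enum; apply/mapP/idP => [[y _ ->]|/eqP <-].
    exact: roots_root.
  by have [y ys /(rootP symf) yx] := sT x; exists y.
Qed.

(** The fibre of [froot f] over a root is the orbit of that root. *)
Lemma sum_order_froots : \sum_(x in froots f) fingraph.order f x = #|T|.
Proof.
rewrite -sum1_card [RHS](partition_big (froot f) (froots f)) => [|x _] /=.
  apply: eq_bigr => x /eqP rx; rewrite sum1_card.
  apply: eq_card => y; rewrite -topredE /=.
  by apply/(rootP (fconnect_sym injf))/eqP; rewrite rx => ->.
by apply/roots_root/fconnect_sym.
Qed.
End Orbits.

(** * Conjugacy and orbit lengths *)

Section Conjugation.
Variables (T U : finType) (f : T -> T) (g : U -> U) (h : T -> U).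
Hypotheses (bijh : bijective h) (hf : h \o f =1 g \o h).

Lemma iter_conj i x : h (iter i f x) = iter i g (h x).
Proof. by elim: i => //= i <-; apply: hf. Qed.

Lemma fconnect_conj x y : fconnect g (h x) (h y) = fconnect f x y.
Proof.
apply/fconnectP/fconnectP => -[i]; last by move->; exists i; rewrite iter_conj.
by rewrite -iter_conj => /(bij_inj bijh) ->; exists i.
Qed.

Lemma order_conj x : fingraph.order g (h x) = fingraph.order f x.
Proof.
rewrite /fingraph.order -(card_image (bij_inj bijh) (fconnect f x)).
have [h' hK h'K] := bijh; apply: eq_card => y.
rewrite -[y]h'K mem_image; last exact: bij_inj.
exact: fconnect_conj.
Qed.

(** The images under [h] of the roots of [f] need not be the canonical roots of [g], but they form a
    transversal of its orbits. *)
Lemma perm_eq_order_conj : injective g ->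
  perm_eq (map (fingraph.order f) (enum (froots f)))
          (map (fingraph.order g) (enum (froots g))).
Proof.
move=> injg; have injh := bij_inj bijh; have [h' hK h'K] := bijh.
have injf : injective f.
  by move=> x y exy; apply/injh/injg; rewrite -[LHS]hf -[RHS]hf /= exy.
have symf := fconnect_sym injf.
rewrite -(eq_map order_conj) map_comp; apply: perm_eq_order_transversal => //.
- by rewrite map_inj_uniq ?enum_uniq.
- move=> _ _ /mapP[x + ->] /mapP[y + ->]; rewrite !mem_enum => /eqP rx /eqP ry.
  by rewrite fconnect_conj => /(rootP symf); rewrite rx ry => ->.
- move=> y; exists (h (froot f (h' y))).
    by rewrite map_f // mem_enum; apply: roots_root.
  by rewrite -{2}[y]h'K fconnect_conj symf connect_root.
Qed.
End Conjugation.

Lemma perm_eq_map2 (T U : eqType) (V : eqType) (f : T -> V) (g : U -> V)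
    (s : seq T) (t : seq U) :
    perm_eq (map f s) (map g t) ->
  exists2 t', perm_eq t' t & map f s = map g t'.
Proof.
case: t => [|y0 t].
  by move/perm_size; case: s => // _; exists [::].
move=> /(perm_iotaP (g y0))[Is]; rewrite size_map => pIs ->.
exists (map (nth y0 (y0 :: t)) Is); first by apply/(perm_iotaP y0); exists Is.
rewrite -map_comp; apply/eq_in_map => i.
rewrite (perm_mem pIs) mem_iota => /andP[_ lti].
exact: nth_map.
Qed.

(** Each root of [f] is paired with a root [b x] of [g] whose orbit has the same length; [h] sends
    the [i]-th iterate of the former to the [i]-th iterate of the latter. *)
Lemma conj_of_perm_eq_order (T U : finType) (f : T -> T) (g : U -> U) :
    injective f -> injective g -> #|T| = #|U| ->
    perm_eq (map (fingraph.order f) (enum (froots f)))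
            (map (fingraph.order g) (enum (froots g))) ->
  exists2 h : T -> U, bijective h & h \o f =1 g \o h.
Proof.
move=> injf injg cTU /perm_eq_map2[t pt eft].
have symf := fconnect_sym injf; have symg := fconnect_sym injg.
set s := enum _ in eft; have us : uniq s by apply: enum_uniq.
have sz : size s = size t.
  by rewrite -(size_map (fingraph.order f)) eft size_map.
have rs x : froot f x \in s by rewrite mem_enum; apply: roots_root.
(* The default is just some element of [U], obtained from [x] by equality of cardinals; by [idt] the
   index is always in range. *)
pose b x := nth (enum_val (cast_ord cTU (enum_rank x))) t (index (froot f x) s).
have idt x : index (froot f x) s < size t by rewrite -sz index_mem.
have bE y0 x : b x = nth y0 t (index (froot f x) s) by apply: set_nth_default.
have bt x : b x \in t by rewrite (bE (b x)) mem_nth.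
have br x : froots g (b x) by have := bt x; rewrite (perm_mem pt) mem_enum.
have ob x : fingraph.order g (b x) = fingraph.order f (froot f x).
  rewrite -[in RHS](nth_index (froot f x) (rs x)).
  by rewrite -(nth_map _ 0) ?index_mem // eft (nth_map (b x)) // -bE.
pose i x := findex f (froot f x) x.
have iE x : iter (i x) f (froot f x) = x.
  by apply: iter_findex; rewrite symf connect_root.
pose h x := iter (i x) g (b x).
exists h => [|x /=].
  apply: inj_card_bij => [x y exy|]; last by rewrite cTU.
  have rg z : froot g (h z) = b z.
    by have /eqP <- := br z; apply/esym/(rootP symg)/fconnect_iter.
  have bxy : b x = b y by rewrite -!rg exy.
  have rxy : froot f x = froot f y.
    apply: (index_inj x (rs x) (rs y)).
    apply/eqP; rewrite -(nth_uniq (b x) (s := t)) // -?bE ?bxy //.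
    by rewrite (perm_uniq pt) enum_uniq.
  (* Both orbits have the same length, so equality of iterates of [g] is a congruence of exponents
     that transfers back to [f]. *)
  move/eqP: exy; rewrite /h bxy eq_iter_order // ob -rxy -eq_iter_order //.
  by rewrite iE rxy iE => /eqP.
have rfx : froot f (f x) = froot f x.
  by apply/esym/(rootP symf)/fconnect1.
have bfx : b (f x) = b x by rewrite (bE (b x)) rfx -bE.
(* When [f x] is the root, [i (f x)] is [0] while [(i x).+1] is the orbit length: the exponents
   agree only modulo the order. *)
have /eqP : iter (i (f x)) g (b x) == iter (i x).+1 g (b x).
  by rewrite eq_iter_order // ob -eq_iter_order // iterS iE -rfx iE.
by rewrite /h bfx iterS.
Qed.

Lemma geq_total : total geq.
Proof. by move=> m n; rewrite orbC; apply: leq_total. Qed.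

Lemma geq_trans : transitive geq.
Proof. by move=> m n k nm mk; apply: leq_trans mk nm. Qed.

Lemma geq_anti : antisymmetric geq.
Proof. by move=> m n; rewrite andbC; apply: anti_leq. Qed.

(** * Cycle types of permutations as integer partitions *)

Section CycleType.
Variable T : finType.
Implicit Types s t : {perm T}.

Definition cycle_lengths s : seq nat :=
  map (fingraph.order s) (enum (froots s)).

Lemma cycle_lengths_intpart s : is_intpart #|T| (sort geq (cycle_lengths s)).
Proof.
apply/and3P; split; first exact/sort_sorted/geq_total.
  by rewrite all_sort; apply/allP => _ /mapP[x _ ->]; apply: fingraph.order_gt0.
rewrite (@perm_sumn _ (cycle_lengths s)) ?perm_sort //.
by rewrite sumnE big_map big_enum sum_order_froots //; apply: perm_inj.
Qed.

Definition cycle_type s : intpart #|T| := Intpart (cycle_lengths_intpart s).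

Lemma eq_cycle_type s t :
  (cycle_type s = cycle_type t) <->
  exists2 f : T -> T, bijective f & f \o s =1 t \o f.
Proof.
have eqE : (cycle_type s = cycle_type t) <->
    perm_eq (cycle_lengths s) (cycle_lengths t).
  split=> [/(congr1 val)/= est|est].
    exact/(perm_sortP geq_total geq_trans geq_anti).
  exact/val_inj/(perm_sortP geq_total geq_trans geq_anti).
split=> [/eqE|[f bf fst]].
  exact/conj_of_perm_eq_order/erefl/perm_inj/perm_inj.
by apply/eqE/(perm_eq_order_conj bf fst)/perm_inj.
Qed.

(** * A permutation with prescribed cycle lengths *)

Section Rotation.
Variable p : seq nat.
Hypothesis p_gt0 : all (fun k => 0 < k) p.

Let S := {i : 'I_(size p) & 'I_(nth 0 p i)}.

(** [S] is a disjoint union of blocks, one per part of [p]; each block becomes a single cycle. *)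
Definition block_rot (u : S) : S := Tagged _ (ordS (tagged u)).

Lemma block_rot_inj : injective block_rot.
Proof.
move=> [i x] [j y] /eqP; rewrite -tag_eqE /tag_eq /= => /andP[/eqP eij].
by case: _ / eij y => y; rewrite tagged_asE => /eqP/ordS_inj ->.
Qed.

(** The zero of block [i], which exists because the parts are positive. *)
Let base (i : 'I_(size p)) : S :=
  Tagged _ (Ordinal (all_nthP 0 p_gt0 i (ltn_ord i))).

Lemma iter_block_rot n i :
  iter n block_rot (base i) =
  Tagged _ (Ordinal (ltn_pmod n (all_nthP 0 p_gt0 i (ltn_ord i)))).
Proof.
elim: n => [|n /= ->]; rewrite /base /block_rot /=; congr Tagged;
  apply: val_inj => /=.
  by rewrite mod0n.
by rewrite -addn1 modnDml addn1.
Qed.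

Lemma fconnect_block_rot i u : fconnect block_rot (base i) u = (tag u == i).
Proof.
apply/fconnectP/eqP => [[n ->]|]; first by rewrite iter_block_rot.
case: u => j x /= eji; case: _ / eji x => x {i}.
exists x; rewrite iter_block_rot; congr Tagged; apply: val_inj => /=.
by rewrite modn_small.
Qed.

(** The orbit of [base i] is block [i], the injective image of an ordinal type of that size. *)
Lemma order_block_rot i : fingraph.order block_rot (base i) = nth 0 p i.
Proof.
rewrite -[RHS]card_ord.
have injT : injective (fun x : 'I_(nth 0 p i) => Tagged _ x : S).
  by move=> x y /eqP; rewrite eq_Tagged => /eqP.
rewrite -(card_image injT predT); apply: eq_card => u.
rewrite [LHS]fconnect_block_rot; apply/eqP/imageP => [|[x _ ->] //].
by case: u => j x /= eji; case: _ / eji x => x; exists x.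
Qed.

Lemma perm_eq_order_block_rot :
  perm_eq p (map (fingraph.order block_rot) (enum (froots block_rot))).
Proof.
have {1}<- : map (fingraph.order block_rot) (map base (enum 'I_(size p))) = p.
  rewrite -map_comp (eq_map order_block_rot) (map_comp (nth 0 p) val).
  by rewrite val_enum_ord map_nth_iota0 // take_size.
apply: perm_eq_order_transversal; first exact: block_rot_inj.
- by rewrite map_inj_uniq ?enum_uniq // => i j /(congr1 tag).
- move=> _ _ /mapP[i _ ->] /mapP[j _ ->].
  by rewrite fconnect_block_rot => /eqP /= ->.
- move=> u; exists (base (tag u));
    by rewrite ?map_f ?mem_enum ?fconnect_block_rot.
Qed.
End Rotation.

Lemma cycle_type_surj (p : intpart #|T|) : exists s, cycle_type s = p.
Proof.
have /and3P[p_sorted p_gt0 /eqP p_sum] := intpart_valP p.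
pose S : finType := {i : 'I_(size p) & 'I_(nth 0 p i)}.
have cST : #|S| = #|T|.
  rewrite -p_sum card_tagged.
  rewrite (eq_map (fun i : 'I_(size p) => card_ord (nth 0 p i))).
  by rewrite (map_comp (nth 0 p) val) val_enum_ord map_nth_iota0 ?take_size.
(* The blocks have total size [#|T|], so [block_rot] can be transported to [T]; conjugation
   preserves its orbit lengths. *)
pose h (u : S) : T := enum_val (cast_ord cST (enum_rank u)).
pose h' (x : T) : S := enum_val (cast_ord (esym cST) (enum_rank x)).
have hK : cancel h h' by move=> u; rewrite /h' enum_valK cast_ordK enum_rankK.
have h'K : cancel h' h by move=> x; rewrite /h enum_valK cast_ordKV enum_rankK.
have injs : injective (h \o @block_rot p \o h').
  apply: inj_comp (can_inj h'K).
  exact: inj_comp (can_inj hK) (@block_rot_inj p).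
exists (perm injs); apply: val_inj => /=.
rewrite -[RHS](sorted_sort geq_trans p_sorted).
apply/(perm_sortP geq_total geq_trans geq_anti).
rewrite perm_sym (perm_trans (perm_eq_order_block_rot p_gt0)) //.
apply: (perm_eq_order_conj (h := h)); last exact: perm_inj.
  by exists h'.
by move=> u; rewrite /= permE /= hK.
Qed.
End CycleType.

(** * Counting classes by a complete invariant *)

Lemma card_equivalence_partition (A B T : finType) (R : rel T) (D : {set T})
    (F : A -> T) (c : A -> B) :
    (forall x, (x \in D) <-> exists a, F a = x) ->
    (forall y, exists a, c a = y) ->
    (forall a b, R (F a) (F b) <-> c a = c b) ->
  #|equivalence_partition R D| = #|B|.
Proof.
move=> DF c_surj RF.
have /fin_all_exists[a aK] := c_surj.
(* The class of [F b] depends only on [c b], so [G], built from a section [a] of [c], is a bijection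
   from [B] onto the classes. *)
pose G y := [set x in D | R (F (a y)) x].
have injG : injective G.
  move=> y z eG; have : F (a z) \in G z.
    by rewrite inE; apply/andP; split; [apply/DF; exists (a z) | apply/RF].
  by rewrite -eG inE => /andP[_ /RF]; rewrite !aK.
have GE b : G (c b) = [set x in D | R (F b) x].
  apply/setP=> x; rewrite !inE; apply: andb_id2l => /DF[d <-].
  by apply/idP/idP => /RF; rewrite ?aK => e; apply/RF; rewrite ?aK.
rewrite -[RHS](card_imset _ injG); apply: eq_card => K.
apply/imsetP/imsetP => [[_ /DF[b <-] ->]|[y _ ->]].
  by exists (c b); rewrite ?GE.
by exists (F (a y)) => //; apply/DF; exists (a y).
Qed.

Theorem corollary3p17 (X : finType) (X_neq0 : (0 < #|X|)%N) :
  (forall r : X * X -> X * X,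
     yang_baxter r -> left_nondegenerate r -> idempotent_fun r ->
     (Lambda r = [set: X] <->
      exists phi : {perm X}, forall x y : X, r (x, y) = (phi y, y)))
  /\
  #|equivalence_partition (@iso_rel X)
      [set r : {ffun X * X -> X * X} |
        `[< [/\ yang_baxter r, left_nondegenerate r, idempotent_fun r
              & bijective (diag r)] >]]|
  = #|{: intpart #|X|}|.
Proof.
split=> [r yb nd idem|].
  rewrite Lambda_setT; split=> [bq|[phi rE]].
    have [phi rE] := bij_diag_perm_solution yb nd idem bq.
    by exists phi => x y; rewrite rE.
  have -> : r = perm_solution phi by apply/funext => -[x y]; rewrite rE.
  exact/perm_solution_bij_diag/injF_bij/perm_inj.
pose F (s : {perm X}) := [ffun u => perm_solution s u].
have FE s : F s = perm_solution s :> (_ -> _).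
  by apply/funext => u; rewrite ffunE.
apply: (card_equivalence_partition (F := F) (c := @cycle_type X)) => [r|p|s t].
- rewrite inE; split=> [/asboolP[yb nd idem bq]|[s <-]].
    have [s rE] := bij_diag_perm_solution yb nd idem bq.
    by exists s; apply/ffunP => u; rewrite ffunE rE.
  (* The braid relation and idempotence hold by computation: both braid composites send [(x, y, z)]
     to [(s (s z), s z, z)]. *)
  apply/asboolP; rewrite FE; split=> // [x|]; first exact/injF_bij/perm_inj.
  exact/perm_solution_bij_diag/injF_bij/perm_inj.
- exact: cycle_type_surj.
rewrite eq_cycle_type -perm_solution_isomorphic /iso_rel !FE.
by split=> /asboolP.
Qed.
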